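(* For every finite nonempty set $S\subset\mathbb{R}^2$ of points in general position there exists a plane straight-line spanning tree $T$ of $S$ that is $\frac{5\pi}{3}$-open. Moreover, this bound is best possible: for every $\varepsilon>0$ there exists a finite set $S\subset\mathbb{R}^2$ of points in general position such that every plane straight-line spanning tree $T$ of $S$ satisfies $\mathrm{op}(T)<\frac{5\pi}{3}+\varepsilon$.
   Context: A finite set $S\subset\mathbb{R}^2$ is in general position if no three of its points are collinear. A plane straight-line graph $G=(S,E)$ on $S$ has vertex set $S$, its edges are straight-line segments connecting two points of $S$, and two edges do not intersect except possibly at common endpoints. A plane straight-line spanning tree of $S$ is a plane straight-line graph on $S$ that is a tree with vertex set $S$. The incident angles of $p\in S$ in $G$ are the angles between two edges of $G$ that appear consecutively in the circular order of the edges incident to $p$ (so for a vertex of degree at least two they sum to $2\pi$). The openness $\mathrm{op}_G(p)$ of $p$ in $G$ is the maximum incident angle of $p$ in $G$; if $p$ has degree at most one, set $\mathrm{op}_G(p)=2\pi$. The openness of $G$ is $\mathrm{op}(G)=\min_{p\in S}\mathrm{op}_G(p)$, and $G$ is called $\varphi$-open if $\mathrm{op}(G)\ge\varphi$. *)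

(* Defs.v *)
From HB Require Import structures.
From mathcomp Require Import all_boot all_order all_algebra finmap.
From mathcomp Require Import boolp classical_sets reals trigo.

Set Implicit Arguments.
Unset Strict Implicit.
Unset Printing Implicit Defensive.

Import Order.TTheory GRing.Theory Num.Theory.

Local Open Scope classical_set_scope.
Local Open Scope ring_scope.

Section Plane.
Variable R : realType.
Implicit Types u v a b p : 'rV[R]_2.

Definition dot u v : R := u 0 0 * v 0 0 + u 0 1 * v 0 1.

Definition cross u v : R := u 0 0 * v 0 1 - u 0 1 * v 0 0.

(* MathComp-Analysis' norm on 'rV[R]_2 is the sup norm. *)
Definition enorm u : R := Num.sqrt (dot u u).

(* For nonzero u and v: the angle in [0, 2 pi[ by which u has to be rotated
   counterclockwise to point in the direction of v. *)
Definition ccw_angle u v : R :=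
  let t := acos (dot u v / (enorm u * enorm v)) in
  if 0 <= cross u v then t else 2 * pi - t.

Definition segment a b : set 'rV[R]_2 :=
  [set x | exists2 t : R, 0 <= t <= 1 & x = (1 - t) *: a + t *: b].

Definition line p v : set 'rV[R]_2 := [set x | exists t : R, x = p + t *: v].

Definition collinear (A : set 'rV[R]_2) : Prop :=
  exists p v, v != 0 /\ A `<=` line p v.

Definition general_position (S : {fset 'rV[R]_2}) : Prop :=
  forall a b c, a \in S -> b \in S -> c \in S ->
  a != b -> a != c -> b != c -> ~ collinear [set a; b; c].

End Plane.

(* A graph on the finite point set S is given by its adjacency relation
   e : rel S, where S is coerced to the finite type of its elements. *)
Section Graph.
Variables (R : realType) (S : {fset 'rV[R]_2}) (e : rel S).
Implicit Types p q a b : S.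

Definition plane_straight_line_graph : Prop :=
  [/\ symmetric e, irreflexive e &
      forall a b c d, e a b -> e c d ->
        [set val a; val b] <> [set val c; val d] ->
        segment (val a) (val b) `&` segment (val c) (val d) `<=`
          [set val a; val b] `&` [set val c; val d]].

Definition acyclic : Prop :=
  forall s : seq S, (2 < size s)%N -> ~ ucycle e s.

Definition plane_spanning_tree : Prop :=
  [/\ plane_straight_line_graph, forall p q, connect e p q & acyclic].

Definition edge_angle p a b : R :=
  ccw_angle (val a - val p) (val b - val p).

(* The edge pb comes immediately after the edge pa in the counterclockwise
   order around p.  For p of degree two, both (a, b) and (b, a) qualify, and
   the two angles sum to 2 pi. *)
Definition consecutive p a b : bool :=
  [&& e p a, e p b, a != b &
      [forall c : S, e p c ==> ~~ (0 < edge_angle p a c < edge_angle p a b)]].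

(* The default 0 of the maximum is harmless: in a plane graph every vertex of
   degree at least two has incident angles, and these are positive. *)
Definition vertex_openness p : R :=
  if (#|e p| <= 1)%N then 2 * pi
  else \big[Num.max/0]_(ab : S * S | consecutive p ab.1 ab.2)
         edge_angle p ab.1 ab.2.

(* The default 2 pi of the minimum is an upper bound of every vertex_openness,
   so it is only relevant when S is empty. *)
Definition openness : R := \big[Num.min/2 * pi]_(p : S) vertex_openness p.

Definition is_open_graph (phi : R) : Prop := phi <= openness.

End Graph.

(* Main.v *)
Require Import Defs.
From HB Require Import structures.
From mathcomp Require Import all_boot all_order all_algebra finmap.
From mathcomp Require Import boolp classical_sets reals trigo.
From mathcomp Require Import ring lra.

(* Let xyz be a triangle of maximum area spanned by S, with yz its shortest
   side, so that its angle at x is at most pi/3.  Join the points of the cone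
   at x spanned by y and z to x, the points beyond the line xy to y, and the
   points beyond the line xz to z.  By maximality of the area, S lies in the
   triangle whose side midpoints are x, y and z; hence there are no points
   in the cone opposite to that of x, the edges at y and at z all lie in
   translates of this opposite cone, and the three stars do not cross.
   For the optimality take an equilateral triangle: a spanning tree has a
   vertex of degree two, where the incident angles are pi/3 and 5 pi/3. *)

Set Implicit Arguments.
Unset Strict Implicit.
Unset Printing Implicit Defensive.

Import Order.TTheory GRing.Theory Num.Theory.
Local Open Scope classical_set_scope.
Local Open Scope ring_scope.

(** * Dot and cross products, norms and cosines in the plane *)

Section PlaneGeometry.
Variable R : realType.
Implicit Types (u v w : 'rV[R]_2) (k s t : R).

Lemma plane_eqP u v : u 0 0 = v 0 0 -> u 0 1 = v 0 1 -> u = v.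
Proof.
move=> uv0 uv1; apply/rowP => -[[|[|//]] i].
  by have -> : Ordinal i = 0 by exact: val_inj.
by have -> : Ordinal i = 1 by exact: val_inj.
Qed.

Lemma crossC u v : cross u v = - cross v u.
Proof. by rewrite /cross; ring. Qed.

Lemma crossvv u : cross u u = 0.
Proof. by rewrite /cross; ring. Qed.

(** Lagrange's identity: it yields Cauchy-Schwarz and links cosines to cross products. *)
Lemma dot_cross_sqr u v :
  dot u v ^+ 2 + cross u v ^+ 2 = dot u u * dot v v.
Proof. by rewrite /dot /cross; ring. Qed.

Lemma dot_ge0 u : 0 <= dot u u.
Proof. by rewrite /dot; nra. Qed.

Lemma dot_gt0 u : u != 0 -> 0 < dot u u.
Proof.
move=> u0; rewrite lt_def dot_ge0 andbT; apply: contra u0 => /eqP uu.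
by apply/eqP/plane_eqP; rewrite mxE; move: uu; rewrite /dot; nra.
Qed.

Lemma enorm_ge0 u : 0 <= enorm u.
Proof. exact: sqrtr_ge0. Qed.

Lemma enorm_sqr u : enorm u ^+ 2 = dot u u.
Proof. by rewrite sqr_sqrtr ?dot_ge0. Qed.

Lemma enorm_gt0 u : u != 0 -> 0 < enorm u.
Proof. by move=> u0; rewrite sqrtr_gt0 dot_gt0. Qed.

Lemma cross_neq0l u v : cross u v != 0 -> u != 0.
Proof. by apply: contraNneq => ->; rewrite /cross !mxE; apply/eqP; ring. Qed.

Lemma dot_le_enorm u v : dot u v <= enorm u * enorm v.
Proof.
have [d0|d0] := lerP (dot u v) 0.
  by rewrite (le_trans d0)// mulr_ge0 ?enorm_ge0.
rewrite -ler_sqr ?nnegrE ?(ltW d0) ?mulr_ge0 ?enorm_ge0//.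
by rewrite exprMn !enorm_sqr -dot_cross_sqr lerDl sqr_ge0.
Qed.

Lemma enormD u v : enorm (u + v) <= enorm u + enorm v.
Proof.
rewrite -ler_sqr ?nnegrE ?addr_ge0 ?enorm_ge0// sqrrD !enorm_sqr.
have := dot_le_enorm u v; rewrite /dot !mxE; lra.
Qed.

Lemma enormZ k u : 0 <= k -> enorm (k *: u) = k * enorm u.
Proof.
move=> k0; have -> : enorm (k *: u) = Num.sqrt (k ^+ 2 * dot u u).
  by congr Num.sqrt; rewrite /dot !mxE; ring.
by rewrite sqrtrM ?sqr_ge0// sqrtr_sqr ger0_norm.
Qed.

Lemma enormN u : enorm (- u) = enorm u.
Proof. by congr Num.sqrt; rewrite /dot !mxE; ring. Qed.

Definition angle_cos u v : R := dot u v / (enorm u * enorm v).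

Lemma angle_cos_le1 u v : u != 0 -> v != 0 -> -1 <= angle_cos u v <= 1.
Proof.
move=> u0 v0; have uv0 : 0 < enorm u * enorm v by rewrite mulr_gt0 ?enorm_gt0.
rewrite ler_pdivrMr// ler_pdivlMr// mul1r dot_le_enorm andbT mulN1r lerNl.
rewrite -(enormN u); apply: le_trans (dot_le_enorm _ _).
by rewrite /dot !mxE; lra.
Qed.

Lemma acos_anti s t : -1 <= s -> s <= t -> t <= 1 -> acos t <= acos s.
Proof.
move=> s1 st t1; have sb : -1 <= s <= 1 by lra.
have tb : -1 <= t <= 1 by lra.
rewrite leNgt -ltr_cos ?in_itv/= ?acos_ge0 ?acos_lepi//.
by rewrite !acosK ?in_itv//= -leNgt.
Qed.

(** With [c = cos (pi / 3)], the triple-angle formula gives [4 c^3 - 3 c = -1], that is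
    [(c + 1) (2 c - 1)^2 = 0]; positivity rules out [c = -1]. *)
Lemma cos_pi_div3 : cos (pi / 3) = 2^-1 :> R.
Proof.
set t := pi / 3; have pi0 := pi_gt0 R.
have ct : 0 < cos t by apply: cos_gt0_pihalf; rewrite /t; lra.
have := cospi R; have -> : pi = t + t *+ 2 by rewrite /t; field.
rewrite cosD cos_mulr2n sin_mulr2n => h.
have := cos2Dsin2 t => h2; apply/eqP; rewrite -subr_eq0 -sqrf_eq0; apply/eqP.
have : (cos t + 1) * (cos t - 2^-1) ^+ 2 = 0.
  move: h h2; set c := cos t; set d := sin t => h h2.
  have -> : (c + 1) * (c - 2^-1) ^+ 2 = 
    4^-1 * (c * (c ^+ 2 *+ 2 - 1) - d * (c * d *+ 2) + 1
      - 2 * c * (1 - (c ^+ 2 + d ^+ 2))) by field.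
  by rewrite h h2; ring.
by move=> /eqP; rewrite mulf_eq0 => /orP[/eqP|/eqP//]; lra.
Qed.

Lemma acos_half : acos 2^-1 = pi / 3 :> R.
Proof.
have pi0 := pi_gt0 R.
by rewrite -cos_pi_div3 cosK// in_itv/=; lra.
Qed.

End PlaneGeometry.

(** * Angles of at most [pi / 3] and the cones they span *)

Section NarrowCones.
Variable R : realType.
Implicit Types (u v w : 'rV[R]_2) (k s t : R).

(** For nonzero vectors: their angle is at most [pi / 3]. Written without division, so that zero
    vectors need no exception. *)
Definition narrow u v := enorm u * enorm v <= 2 * dot u v.

Lemma narrowN u v : narrow (- u) (- v) = narrow u v.
Proof. by rewrite /narrow !enormN; congr (_ <= 2 * _); rewrite /dot !mxE; ring. Qed.

(** By the triangle inequality the product of the norms expands into squares and mixed terms;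
    [narrow u v] bounds the mixed ones, and the squares occur doubled on the right. *)
Lemma narrow_cone u v s t s' t' : narrow u v ->
    0 <= s -> 0 <= t -> 0 <= s' -> 0 <= t' ->
  narrow (s *: u + t *: v) (s' *: u + t' *: v).
Proof.
rewrite /narrow => uv s0 t0 s0' t0'.
have norm_le k l : 0 <= k -> 0 <= l ->
    enorm (k *: u + l *: v) <= k * enorm u + l * enorm v.
  by move=> k0 l0; rewrite (le_trans (enormD _ _))// !enormZ.
apply: le_trans (ler_pM (enorm_ge0 _) (enorm_ge0 _)
  (norm_le _ _ s0 t0) (norm_le _ _ s0' t0')) _.
have -> : dot (s *: u + t *: v) (s' *: u + t' *: v) =
    s * s' * dot u u + t * t' * dot v v + (s * t' + t * s') * dot u v.
  by rewrite /dot !mxE; ring.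
rewrite -!enorm_sqr.
have ss : 0 <= s * s' by rewrite mulr_ge0.
have tt : 0 <= t * t' by rewrite mulr_ge0.
have st : 0 <= s * t' + t * s' by rewrite addr_ge0 ?mulr_ge0.
have h1 := mulr_ge0 ss (sqr_ge0 (enorm u)).
have h2 := mulr_ge0 tt (sqr_ge0 (enorm v)).
have h3 := ler_wpM2l st uv.
lra.
Qed.

Lemma angle_cos_narrow u v : u != 0 -> v != 0 -> narrow u v ->
  2^-1 <= angle_cos u v.
Proof.
move=> u0 v0 uv; have p0 : 0 < enorm u * enorm v by rewrite mulr_gt0 ?enorm_gt0.
by rewrite ler_pdivlMr//; move: uv; rewrite /narrow; lra.
Qed.

Lemma ccw_angleE u v :
  ccw_angle u v = if 0 <= cross u v then acos (angle_cos u v)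
                  else 2 * pi - acos (angle_cos u v).
Proof. by []. Qed.

Lemma ccw_angle_parallel u v : u != 0 -> v != 0 -> cross u v = 0 ->
  0 < dot u v -> ccw_angle u v = 0.
Proof.
move=> u0 v0 c0 d0; rewrite ccw_angleE c0 lexx.
have -> : angle_cos u v = 1; last exact: acos1.
have p0 : 0 < enorm u * enorm v by rewrite mulr_gt0 ?enorm_gt0.
rewrite /angle_cos; suff -> : dot u v = enorm u * enorm v by rewrite divff ?gt_eqF.
apply/eqP; rewrite -(@eqrXn2 _ 2) ?ltW//.
by rewrite exprMn !enorm_sqr -dot_cross_sqr c0; apply/eqP; ring.
Qed.

(* Divided by [dot u v * dot u w], the last hypothesis compares the tangents of
   the two angles. *)
Lemma angle_cos_mono u v w : u != 0 -> v != 0 -> w != 0 ->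
    0 < dot u v -> 0 < dot u w ->
    0 <= cross v u -> cross v u * dot u w <= cross w u * dot u v ->
  angle_cos u w <= angle_cos u v.
Proof.
move=> u0 v0 w0 uv uw c0 tan_le.
have [nu nv nw] := And3 (enorm_gt0 u0) (enorm_gt0 v0) (enorm_gt0 w0).
rewrite /angle_cos ler_pdivrMr ?mulr_gt0// mulrAC ler_pdivlMr ?mulr_gt0//.
suff h : dot u w * enorm v <= dot u v * enorm w.
  by have := ler_wpM2l (ltW nu) h; lra.
have [l0 r0] : 0 <= dot u w * enorm v /\ 0 <= dot u v * enorm w.
  by split; rewrite mulr_ge0 ?ltW.
rewrite -ler_sqr// !exprMn !enorm_sqr.
have: (cross v u * dot u w) ^+ 2 <= (cross w u * dot u v) ^+ 2.
  have c1 : 0 <= cross v u * dot u w by rewrite mulr_ge0// ltW.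
  by rewrite ler_sqr// nnegrE (le_trans c1).
rewrite !exprMn => h.
(* The factor [dot u u] makes Lagrange's identity apply on both sides; the term
   [dot u v ^+ 2 * dot u w ^+ 2] cancels and [h] remains. *)
rewrite -(ler_pM2l (dot_gt0 u0)).
have -> : dot u u * (dot u w ^+ 2 * dot v v) = dot u w ^+ 2 * (dot u u * dot v v).
  by ring.
have -> : dot u u * (dot u v ^+ 2 * dot w w) = dot u v ^+ 2 * (dot u u * dot w w).
  by ring.
rewrite -!dot_cross_sqr (crossC u v) (crossC u w); lra.
Qed.

End NarrowCones.

(** * From pairwise narrow edges at a vertex to its openness *)

Section VertexOpenness.
Variables (R : realType) (S : {fset 'rV[R]_2}) (e : rel S).
Implicit Types p a b c r : S.

(** The edges at [p] form a fan of angle at most [pi / 3]; turning counterclockwise from its last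
    edge [a] to its first edge [b] sweeps an incident angle of at least [5 * pi / 3]. *)
Lemma vertex_openness_ge p :
    (forall a b, e p a -> e p b -> a != b ->
       cross (val a - val p) (val b - val p) != 0 /\
       narrow (val a - val p) (val b - val p)) ->
  5 * pi / 3 <= vertex_openness e p.
Proof.
move=> nar; have pi0 := pi_gt0 R; rewrite /vertex_openness.
case: leqP => [_|/card_gt1P[r [r' [er er' rr']]]]; first lra.
set d := fun c => val c - val p.
have d0 c : e p c -> d c != 0.
  move=> ec; have [->|cr] := eqVneq c r.
    by have [/cross_neq0l] := nar _ _ er er' rr'.
  by have [/cross_neq0l] := nar _ _ ec er cr.
have dot0 a b : e p a -> e p b -> 0 < dot (d a) (d b).
  move=> ea eb; have [->|ab] := eqVneq a b; first by rewrite dot_gt0 ?d0.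
  have [_ h] := nar _ _ ea eb ab.
  have : 0 < enorm (d a) * enorm (d b) by rewrite mulr_gt0 ?enorm_gt0 ?d0.
  by move: h; rewrite /narrow -/(d a) -/(d b); lra.
(* The tangent of the signed angle from [d r] to [d c]. All dot products are positive, so tangents
   order the edges counterclockwise. *)
pose t c := cross (d r) (d c) / dot (d r) (d c).
have tP b c : e p b -> e p c -> t b <= t c -> 0 <= cross (d b) (d c).
  move=> eb ec; rewrite ler_pdivrMr ?dot0// mulrAC ler_pdivlMr ?dot0// => h.
  rewrite -(pmulr_rge0 _ (dot0 _ _ er er)).
  have -> : dot (d r) (d r) * cross (d b) (d c) =
    cross (d r) (d c) * dot (d r) (d b) - cross (d r) (d b) * dot (d r) (d c).
    by rewrite /dot /cross; ring.
  by rewrite subr_ge0.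
have [a ea amax] := @arg_maxP _ _ _ r (e p) t er.
have [b eb bmin] := @arg_minP _ _ _ r (e p) t er.
have ca c : e p c -> 0 <= cross (d c) (d a) by move=> ec; apply: tP => //; exact: amax.
have cb c : e p c -> 0 <= cross (d b) (d c) by move=> ec; apply: tP => //; exact: bmin.
have par c c' : e p c -> e p c' -> cross (d c) (d c') = 0 -> c = c'.
  move=> ec ec' cc'; apply: contraTeq isT => ne.
  by have [] := nar _ _ ec ec' ne; rewrite -/(d c) -/(d c') cc' eqxx.
(* If the two extremes coincided, all edges would be parallel to [d a], hence equal, against
   [rr']. *)
have ab : a != b.
  apply/eqP => ab; have eqa c : e p c -> c = a.
    move=> ec; apply: par => //; apply/eqP; rewrite eq_le ca// andbT.
    by rewrite crossC oppr_le0 ab cb.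
  by move: rr'; rewrite (eqa r)// (eqa r')// eqxx.
have [cab nab] := nar _ _ ea eb ab.
have cab0 : cross (d a) (d b) < 0.
  by rewrite lt_def eq_sym cab crossC oppr_le0 ca.
have lt_ab : (0 <= cross (d a) (d b)) = false by rewrite leNgt cab0.
have aE : edge_angle p a b = 2 * pi - acos (angle_cos (d a) (d b)).
  by rewrite /edge_angle ccw_angleE -/(d a) -/(d b) lt_ab.
have cos_ab := angle_cos_narrow (d0 _ ea) (d0 _ eb) nab.
have /andP[_ cos_ab1] := angle_cos_le1 (d0 _ ea) (d0 _ eb).
apply: (@bigmax_sup _ _ _ _ (a, b)) => /=; last first.
  have h : -1 <= 2^-1 :> R by lra.
  by have := acos_anti h cos_ab cos_ab1; rewrite acos_half aE; lra.
(* No edge [c] comes strictly between: either it is parallel to [a], at angle [0], or its reflex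
   angle from [a] is at least that of the extreme edge [b]. *)
apply/and4P; split=> //; apply/forallP => c; apply/implyP => ec.
apply/negP => /andP[ac0]; apply/negP; rewrite -leNgt.
have [ca0|ca0] := eqVneq (cross (d a) (d c)) 0.
  by move: ac0; rewrite /edge_angle ccw_angle_parallel ?d0 ?dot0 ?ltxx.
have lt_ac : (0 <= cross (d a) (d c)) = false.
  by apply/negbTE; rewrite -ltNge lt_def eq_sym ca0 crossC oppr_le0 ca.
rewrite aE /edge_angle ccw_angleE -/(d a) -/(d c) lt_ac lerD2l lerN2.
have /andP[_ cos_ac1] := angle_cos_le1 (d0 _ ea) (d0 _ ec).
apply: acos_anti => //; first by lra.
apply: angle_cos_mono; rewrite ?d0 ?dot0 ?ca//.
rewrite -subr_ge0.
have -> : cross (d b) (d a) * dot (d a) (d c) - cross (d c) (d a) * dot (d a) (d b)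
  = dot (d a) (d a) * cross (d b) (d c) by rewrite /dot /cross; ring.
by rewrite mulr_ge0 ?cb ?dot_ge0.
Qed.

End VertexOpenness.

(** * Intersecting segments and collinear points *)

Section Segments.
Variable R : realType.
Implicit Types (a b c : 'rV[R]_2).

Lemma segmentC a b : segment a b = segment b a.
Proof.
by apply/seteqP; split=> w [t tb ->]; exists (1 - t); rewrite ?subKr 1?addrC//; lra.
Qed.

Lemma segments_meet_at_end a b c : cross (a - c) (b - c) != 0 ->
  segment a c `&` segment b c `<=` [set c].
Proof.
move=> ab0 w [[k _ ->]] [l _ /rowP kl]; move: (kl 0) (kl 1).
rewrite !mxE => kl0 kl1.
have : (1 - k) * cross (a - c) (b - c) = 0.
  have h0 : (1 - k) * (a - c) 0 0 = (1 - l) * (b - c) 0 0 by rewrite !mxE; lra.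
  have h1 : (1 - k) * (a - c) 0 1 = (1 - l) * (b - c) 0 1 by rewrite !mxE; lra.
  have -> : (1 - k) * cross (a - c) (b - c) =
    (1 - k) * (a - c) 0 0 * (b - c) 0 1 - (1 - k) * (a - c) 0 1 * (b - c) 0 0.
    by rewrite /cross; ring.
  by rewrite h0 h1; ring.
move/eqP; rewrite mulf_eq0 (negbTE ab0) orbF => /eqP k1.
have k1' : k = 1 by lra.
by rewrite k1' subrr scale0r add0r scale1r.
Qed.

Lemma collinear_cross a b c : a != b -> cross (b - a) (c - a) = 0 ->
  collinear [set a; b; c].
Proof.
move=> ab c0; have ba0 : b - a != 0 by rewrite subr_eq0 eq_sym.
exists a, (b - a); split=> // w [[->|->]|->].
- by exists 0; rewrite scale0r addr0.
- by exists 1; rewrite scale1r addrC subrK.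
have d0 : dot (b - a) (b - a) != 0 by rewrite gt_eqF// dot_gt0.
(* The coefficient of the orthogonal projection of [c - a] onto [b - a]; the projection is [c - a]
   itself, as the cross product vanishes. *)
exists (dot (b - a) (c - a) / dot (b - a) (b - a)).
have E u v : dot u u != 0 -> cross u v = 0 -> v = (dot u v / dot u u) *: u.
  move=> u0 uv; apply: plane_eqP; rewrite !mxE; apply: (mulIf u0);
    rewrite mulrAC divfK//; move: uv; rewrite /dot /cross => uv.
    have -> : v 0 0 * (u 0 0 * u 0 0 + u 0 1 * u 0 1) =
      (u 0 0 * v 0 0 + u 0 1 * v 0 1) * u 0 0
      - u 0 1 * (u 0 0 * v 0 1 - u 0 1 * v 0 0) by ring.
    by rewrite uv; ring.
  have -> : v 0 1 * (u 0 0 * u 0 0 + u 0 1 * u 0 1) =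
      (u 0 0 * v 0 0 + u 0 1 * v 0 1) * u 0 1
      + u 0 0 * (u 0 0 * v 0 1 - u 0 1 * v 0 0) by ring.
  by rewrite uv; ring.
by rewrite -E// addrC subrK.
Qed.

End Segments.

(** * Trees given by parent pointers *)

Section HubGraph.
Variables (R : realType) (S : {fset 'rV[R]_2}) (hub : S -> S).
Implicit Types (p q : S).

(** Each vertex points to its parent [hub p]. A root is a fixed point of [hub], where [p != q]
    suppresses the loop. *)
Definition hub_graph : rel S :=
  fun p q => (p != q) && ((hub p == q) || (hub q == p)).

Lemma hub_graph_sym : symmetric hub_graph.
Proof. by move=> p q; rewrite /hub_graph eq_sym orbC. Qed.

Lemma hub_graph_edge p q : hub_graph p q ->
  exists c, [/\ hub c != c,
    segment (val p) (val q) = segment (val c) (val (hub c)) &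
    [set val p; val q] = [set val c; val (hub c)]].
Proof.
move=> /andP[pq /orP[/eqP h|/eqP h]].
  by exists p; rewrite h eq_sym.
by exists q; rewrite h segmentC setUC.
Qed.

(** Every edge is the pointer of a non-root vertex, and equal tails give equal edges, so only
    pointers with different tails are compared. *)
Lemma hub_graph_plane :
    (forall p q, p != q -> hub p != p -> hub q != q ->
      segment (val p) (val (hub p)) `&` segment (val q) (val (hub q)) `<=`
        [set val p; val (hub p)] `&` [set val q; val (hub q)]) ->
  plane_straight_line_graph hub_graph.
Proof.
move=> H; split=> [|p|a b c d ab cd].
- exact: hub_graph_sym.
- by rewrite /hub_graph eqxx.
have [p [hp -> ->]] := hub_graph_edge ab.
have [q [hq -> ->]] := hub_graph_edge cd => ne.
by apply: H => //; apply: contra_notN ne => /eqP ->.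
Qed.

Variable rank : S -> nat.
Hypothesis rank_hub : forall p, hub p != p -> (rank (hub p) < rank p)%N.

(** Following pointers lowers [rank], so it ends at the only possible fixed point. *)
Lemma hub_graph_connect (root : S) : (forall p, hub p = p -> p = root) ->
  forall p q, connect hub_graph p q.
Proof.
move=> uniq_root.
have to_root n : forall p, (rank p < n)%N -> connect hub_graph p root.
  elim: n => // n IHn p pn; have [/uniq_root ->//|hp] := eqVneq (hub p) p.
  apply: (connect_trans (connect1 _) (IHn (hub p) _)).
    by rewrite /hub_graph eq_sym hp eqxx.
  exact: leq_trans (rank_hub hp) pn.
move=> p q; apply: (connect_trans (to_root _ p (ltnSn _))).
by rewrite (sym_connect_sym hub_graph_sym) (to_root _ q (ltnSn _)).
Qed.

(* In a cycle, both neighbours of a vertex of maximal rank would be its hub. *)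
Lemma hub_graph_acyclic : acyclic hub_graph.
Proof.
case=> // p0 s; set s0 := p0 :: s => s2 cyc.
have [p ps pmax] := @arg_maxnP _ p0 (mem s0) rank (mem_head _ _).
have hubp q : q \in s0 -> hub_graph p q -> q = hub p.
  move=> qs /andP[pq /orP[/eqP//|/eqP hq]].
  by have := @rank_hub q; rewrite hq pq => /(_ isT); rewrite ltnNge => /negP[]; exact: pmax.
(* Once the cycle starts at [p], the neighbours of [p] are its second and its last vertex. Both
   equal [hub p], but they are distinct as the cycle has more than two vertices. *)
have [i s' rot_s] := rot_to ps.
have mems' q : q \in p :: s' -> q \in s0 by rewrite -rot_s mem_rot.
have size_s' : (1 < size s')%N by rewrite -ltnS -[(size s').+1]/(size (p :: s')) -rot_s size_rot.
move: cyc; rewrite -(rot_ucycle i) rot_s.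
case: s' {rot_s} size_s' mems' => // a [//|b s'] _ mems' /andP[].
rewrite /= -cats1 cat_path /= andbT => /and4P[pa _ _ lastp].
rewrite [a \in _]in_cons => /and4P[_ a_notin _ _].
have ea : a = hub p by apply: hubp => //; rewrite mems'// !inE eqxx orbT.
have eb : last b s' = hub p.
  apply: hubp; last by rewrite hub_graph_sym.
  by rewrite mems'// inE in_cons mem_last !orbT.
by case/negP: a_notin; rewrite ea -eb -in_cons mem_last.
Qed.

End HubGraph.

(** * A triangle of maximum area with a narrow corner *)

Section LargestTriangle.
Variables (R : realType) (S : {fset 'rV[R]_2}).
Implicit Types (a b c p q : S).

(** Twice the unsigned area of the triangle [abc]. *)
Definition area2 a b c : R := `|cross (val b - val a) (val c - val a)|.

Lemma area2_rot a b c : area2 a b c = area2 b c a.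
Proof. by congr `|_|; rewrite /cross !mxE; ring. Qed.

(** Among the triples of maximum area take one with shortest [yz]. With [u], [v] the sides at [x],
    [|u|^2 + |v|^2 - 2 dot u v] is at most [|u|^2] and [|v|^2], so [2 dot u v] is at least both
    squares and thus at least [|u| |v|]. *)
Lemma largest_triangle a0 b0 c0 : exists x y z,
  [/\ forall a b c, area2 a b c <= area2 x y z,
      area2 a0 b0 c0 <= area2 x y z &
      narrow (val y - val x) (val z - val x)].
Proof.
pose area (t : S * S * S) := area2 t.1.1 t.1.2 t.2.
pose base (t : S * S * S) := dot (val t.1.2 - val t.2) (val t.1.2 - val t.2).
have [m _ mmax] := @arg_maxP _ _ _ (a0, b0, c0) predT area isT.
have [[[x y] z] /= /eqP tm tmin] :=
  @arg_minP _ _ _ m (fun t => area t == area m) base (eqxx _).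
have area_xyz a b c : area2 a b c <= area2 x y z.
  by rewrite [area2 x y z]tm; exact: (mmax (a, b, c)).
exists x, y, z; split=> //.
(* Rotated triples have the same area, so they compete in the minimisation of [base]. *)
have xy : base (x, y, z) <= base (z, x, y).
  by apply: tmin; rewrite -tm; apply/eqP; rewrite /area /= area2_rot.
have xz : base (x, y, z) <= base (y, z, x).
  by apply: tmin; rewrite -tm; apply/eqP; rewrite /area /= -area2_rot.
move: xy xz; rewrite /base /=.
set u := val y - val x; set v := val z - val x.
have -> : dot (val y - val z) (val y - val z) = dot u u + dot v v - 2 * dot u v.
  by rewrite /u /v /dot !mxE; ring.
have -> : dot (val x - val y) (val x - val y) = dot u u.
  by rewrite /u /dot !mxE; ring.
rewrite /narrow -!enorm_sqr => h1 h2.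
have [le|le] := leP (enorm u) (enorm v).
  by have := ler_wpM2r (enorm_ge0 v) le; lra.
by have := ler_wpM2l (enorm_ge0 u) (ltW le); lra.
Qed.

End LargestTriangle.

(** * The tree of three stars centred at the corners of the triangle *)

Section TriangleTree.
Variables (R : realType) (S : {fset 'rV[R]_2}).
Implicit Types (a b c p q : S) (w : 'rV[R]_2) (k l : R).

Hypothesis gp : forall a b c, a != b -> a != c -> b != c ->
  cross (val b - val a) (val c - val a) != 0.

Variables x y z : S.
Let u := val y - val x.
Let v := val z - val x.
Hypothesis uv0 : cross u v != 0.
Hypothesis uv_narrow : narrow u v.
Hypothesis xyz_max : forall a b c, area2 a b c <= area2 x y z.

(** By Cramer's rule, [s] and [t] are the affine coordinates with origin [x] and basis [u], [v]. *)
Let s w := cross (w - val x) v / cross u v.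
Let t w := cross u (w - val x) / cross u v.

Let coordE w : w = val x + (s w *: u + t w *: v).
Proof.
apply: plane_eqP; rewrite !mxE; apply: (mulIf uv0); rewrite /s /t;
  move: uv0; rewrite /cross !mxE => uv0'; field; exact: uv0'.
Qed.

Let s_seg k w w' : s ((1 - k) *: w + k *: w') = (1 - k) * s w + k * s w'.
Proof. by rewrite /s mulrA [in RHS]mulrA -mulrDl; congr (_ / _); rewrite /cross !mxE; ring. Qed.

Let t_seg k w w' : t ((1 - k) *: w + k *: w') = (1 - k) * t w + k * t w'.
Proof. by rewrite /t mulrA [in RHS]mulrA -mulrDl; congr (_ / _); rewrite /cross !mxE; ring. Qed.

Let sx : s (val x) = 0. Proof. by rewrite /s /cross !mxE subrr subrr; ring. Qed.
Let tx : t (val x) = 0. Proof. by rewrite /t /cross !mxE subrr subrr; ring. Qed.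
Let sy : s (val y) = 1. Proof. by rewrite /s divff. Qed.
Let ty : t (val y) = 0. Proof. by rewrite /t crossvv mul0r. Qed.
Let sz : s (val z) = 0. Proof. by rewrite /s crossvv mul0r. Qed.
Let tz : t (val z) = 1. Proof. by rewrite /t divff. Qed.

Let xy : x != y.
Proof. by apply: contra_neq uv0 => e; rewrite /u e subrr /cross !mxE; ring. Qed.
Let xz : x != z.
Proof. by apply: contra_neq uv0 => e; rewrite /v e subrr /cross !mxE; ring. Qed.
Let yz : y != z.
Proof. by apply: contra_neq uv0 => e; rewrite /u e crossvv. Qed.

Let yx : y != x. Proof. by rewrite eq_sym. Qed.
Let zx : z != x. Proof. by rewrite eq_sym. Qed.

Let norm_ratio_le1 k : `|k| <= `|cross u v| -> -1 <= k / cross u v <= 1.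
Proof.
by move=> k1; rewrite -ler_norml normrM normfV ler_pdivrMr ?normr_gt0// mul1r.
Qed.

(** Replacing one corner of [xyz] by [p] multiplies the area by [|s|], [|t|] or [|1 - s - t|]; by
    maximality none of these exceeds [1]. *)
Let coord_bounds p : [/\ s (val p) <= 1, t (val p) <= 1 &
  0 <= s (val p) + t (val p)].
Proof.
have /andP[_ s1] := norm_ratio_le1 (xyz_max x p z).
have /andP[_ t1] := norm_ratio_le1 (xyz_max x y p).
have /andP[_ st] := norm_ratio_le1 (xyz_max y z p).
split=> //; move: st.
have -> : cross (val z - val y) (val p - val y) / cross u v =
    1 - (s (val p) + t (val p)).
  rewrite /s /t; move: uv0; rewrite /u /v /cross !mxE => uv0'; field; exact: uv0'.
lra.
Qed.

(** The order of the tests is immaterial: [s + t >= 0] on [S], so they cannot both succeed. The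
    corners [y] and [z] bound the cone at [x] and get hub [x]. *)
Definition triangle_hub p : S :=
  if t (val p) < 0 then y else if s (val p) < 0 then z else x.

(** Next to each negative coordinate stands the sign that [s + t >= 0] forces on the other one. *)
Variant hub_spec p : S -> Type :=
  | HubY of t (val p) < 0 & 0 < s (val p) : hub_spec p y
  | HubZ of s (val p) < 0 & 0 < t (val p) : hub_spec p z
  | HubX of 0 <= s (val p) & 0 <= t (val p) : hub_spec p x.

Lemma triangle_hubP p : hub_spec p (triangle_hub p).
Proof.
have [_ _ st] := coord_bounds p; rewrite /triangle_hub.
case: (ltrP (t (val p)) 0) => [tn|tn]; first by constructor => //; lra.
by case: (ltrP (s (val p)) 0) => [sn|sn]; constructor => //; lra.
Qed.

Let hub_x : triangle_hub x = x.
Proof. by rewrite /triangle_hub tx sx ltxx. Qed.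
Let hub_y : triangle_hub y = x.
Proof. by rewrite /triangle_hub ty sy ltxx ltr10. Qed.
Let hub_z : triangle_hub z = x.
Proof. by rewrite /triangle_hub tz sz ltr10 ltxx. Qed.

Let T := hub_graph triangle_hub.

(** A bound on the depth: children of [x] other than [y] and [z] also get [2], as only the strict
    drop along the hubs counts. *)
Let rank p : nat := if p == x then 0 else if (p == y) || (p == z) then 1 else 2.

Let rank_hub p : triangle_hub p != p -> (rank (triangle_hub p) < rank p)%N.
Proof.
have [->|px] := eqVneq p x; first by rewrite hub_x eqxx.
have [->|py] := eqVneq p y; first by rewrite hub_y /rank !eqxx (negbTE yx).
have [->|pz] := eqVneq p z.
  by rewrite hub_z /rank !eqxx (negbTE zx) orbT.
rewrite /rank (negbTE px) (negbTE py) (negbTE pz) /= => _.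
by case: (triangle_hubP p) => _ _; rewrite ?eqxx ?(negbTE yx) ?(negbTE zx) ?orbT.
Qed.

Let root_x p : triangle_hub p = p -> p = x.
Proof.
by case: (triangle_hubP p) => [h _ e|h _ e|//]; move: h; rewrite -e ?ty ?sz ltxx.
Qed.

(** The affine form [f] is nonnegative on the first segment and negative on the second except at
    [c], so they can meet only at [c]. As [c] is not [x], the first segment reaches it only if [f]
    vanishes at [p]. Used with [t] for the line [xy] and [s] for [xz]. *)
Let segments_meet_on_line (f : 'rV[R]_2 -> R) c p q w :
    (forall k w w', f ((1 - k) *: w + k *: w') = (1 - k) * f w + k * f w') ->
    x != c -> f (val x) = 0 -> f (val c) = 0 -> 0 <= f (val p) -> f (val q) < 0 ->
    segment (val p) (val x) w -> segment (val q) (val c) w ->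
  w = val c /\ f (val p) = 0.
Proof.
move=> f_seg xc fx fc fp fq [k /andP[k0 k1] ew] [l /andP[l0 l1] ew'].
have fw : f w = (1 - k) * f (val p) by rewrite ew f_seg fx; ring.
have fw' : f w = (1 - l) * f (val q) by rewrite ew' f_seg fc; ring.
have l1' : l = 1 by nra.
have wc : w = val c by rewrite ew' l1' subrr scale0r add0r scale1r.
split=> //; move: fw; rewrite wc fc => /esym/eqP; rewrite mulf_eq0.
case/orP => [/eqP k1'|/eqP//]; case/eqP: xc; apply: val_inj.
by rewrite -wc ew k1' scale0r add0r (_ : k = 1) ?scale1r//; lra.
Qed.

Let t_eq0 p : p != x -> t (val p) = 0 -> p = y.
Proof.
move=> px /eqP; rewrite mulf_eq0 invr_eq0 (negbTE uv0) orbF => tp.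
by apply: contraTeq tp => py; apply: gp; rewrite // eq_sym.
Qed.

Let s_eq0 p : p != x -> s (val p) = 0 -> p = z.
Proof.
move=> px /eqP; rewrite mulf_eq0 invr_eq0 (negbTE uv0) orbF => sp.
by apply: contraTeq sp => pz; apply: gp; rewrite // eq_sym.
Qed.

(** The coordinate [s] separates the segments: it is positive on the first and at most [0] on the
    second. *)
Let disjoint_yz p q w : t (val p) < 0 -> 0 < s (val p) ->
    s (val q) < 0 -> 0 < t (val q) ->
  segment (val p) (val y) w -> ~ segment (val q) (val z) w.
Proof.
move=> tp sp sq tq [k /andP[k0 k1] ew] [l /andP[l0 l1] ew'].
have swy : s w = (1 - k) * s (val p) + k by rewrite ew s_seg sy; ring.
have swz : s w = (1 - l) * s (val q) by rewrite ew' s_seg sz; ring.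
have : s w <= 0 by rewrite swz; nra.
apply/negP; rewrite -ltNge swy; have [->|k0'] := eqVneq k 0; first lra.
apply: ltr_wpDl; last by rewrite lt_def k0'.
by rewrite mulr_ge0 ?subr_ge0 ?(ltW sp).
Qed.

Let same_hub p q c : p != q -> c != p -> c != q ->
  segment (val p) (val c) `&` segment (val q) (val c) `<=`
    [set val p; val c] `&` [set val q; val c].
Proof.
move=> pq cp cq w /segments_meet_at_end -> //; first by split; right.
by apply: gp.
Qed.

Lemma triangle_tree_plane : plane_straight_line_graph T.
Proof.
apply: hub_graph_plane => p q pq hp hq.
have px : p != x by apply: contraNneq hp => ->; rewrite hub_x.
have qx : q != x by apply: contraNneq hq => ->; rewrite hub_x.
have meet_xy a b w : a != x -> 0 <= t (val a) -> t (val b) < 0 ->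
    segment (val a) (val x) w -> segment (val b) (val y) w -> w = val y /\ a = y.
  move=> ax ta tb wa wb.
  by have [? /(t_eq0 ax)] := segments_meet_on_line t_seg xy tx ty ta tb wa wb.
have meet_xz a b w : a != x -> 0 <= s (val a) -> s (val b) < 0 ->
    segment (val a) (val x) w -> segment (val b) (val z) w -> w = val z /\ a = z.
  move=> ax sa sb wa wb.
  by have [? /(s_eq0 ax)] := segments_meet_on_line s_seg xz sx sz sa sb wa wb.
(* Edges with one hub meet only there, those with hubs [y] and [z] are disjoint, and an edge at [x]
   meets one with hub [y] or [z] only if it is the side [xy] or [xz], at that hub. *)
move: hp hq; case: (triangle_hubP p) => [tp sp|sp tp|sp tp];
  case: (triangle_hubP q) => [tq sq|sq tq|sq tq] hp hq; try exact: same_hub.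
- by move=> w [wp wq]; case: (disjoint_yz tp sp sq tq wp wq).
- move=> w [wp wq]; have [-> ->] := meet_xy q p w qx tq tp wq wp.
  by split; [right|left].
- by move=> w [wp wq]; case: (disjoint_yz tq sq sp tp wq wp).
- move=> w [wp wq]; have [-> ->] := meet_xz q p w qx sq sp wq wp.
  by split; [right|left].
- move=> w [wp wq]; have [-> ->] := meet_xy p q w px tp tq wp wq.
  by split; [left|right].
- move=> w [wp wq]; have [-> ->] := meet_xz p q w px sp sq wp wq.
  by split; [left|right].
Qed.

Lemma triangle_tree_spanning : plane_spanning_tree T.
Proof.
split; first exact: triangle_tree_plane.
  exact: (hub_graph_connect rank_hub root_x).
exact: (hub_graph_acyclic rank_hub).
Qed.

Let cone (u' v' : 'rV[R]_2) w := exists k l,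
  [/\ 0 <= k, 0 <= l & w = k *: u' + l *: v'].

Let cone_narrow u' v' w w' : narrow u' v' -> cone u' v' w -> cone u' v' w' ->
  narrow w w'.
Proof.
by move=> n [k [l [k0 l0 ->]]] [k' [l' [k0' l0' ->]]]; apply: narrow_cone.
Qed.

Let cone_x p : triangle_hub p = x -> cone u v (val p - val x).
Proof.
case: (triangle_hubP p) => [||s0 t0 _]; [by move=> _ _ /eqP; rewrite eq_sym (negbTE xy)
  | by move=> _ _ /eqP; rewrite eq_sym (negbTE xz) |].
exists (s (val p)), (t (val p)); split=> //.
by rewrite {1}(coordE (val p)) addrC addKr.
Qed.

(** The coefficients along [- u] and [- v] are [1 - s] and [- t], where [s <= 1] by maximality of
    the area; the edge to [x] is [- u] itself. *)
Let cone_y p : T y p -> cone (- u) (- v) (val p - val y).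
Proof.
move=> /andP[yp]; rewrite hub_y => /orP[/eqP <-|].
  exists 1, 0; split=> //; apply: plane_eqP; rewrite !mxE; ring.
case: (triangle_hubP p) => [t0 s0 _||]; last by rewrite (negbTE xy).
  have [s1 _ _] := coord_bounds p.
  exists (1 - s (val p)), (- t (val p)); split; [lra|lra|].
  by rewrite {1}(coordE (val p)); apply: plane_eqP; rewrite !mxE; ring.
by rewrite eq_sym (negbTE yz).
Qed.

Let cone_z p : T z p -> cone (- u) (- v) (val p - val z).
Proof.
move=> /andP[zp]; rewrite hub_z => /orP[/eqP <-|].
  exists 0, 1; split=> //; apply: plane_eqP; rewrite !mxE; ring.
case: (triangle_hubP p) => [|s0 t0 _|]; last by rewrite (negbTE xz).
  by rewrite (negbTE yz).
have [_ t1 _] := coord_bounds p.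
exists (- s (val p)), (1 - t (val p)); split; [lra|lra|].
by rewrite {1}(coordE (val p)); apply: plane_eqP; rewrite !mxE; ring.
Qed.

Lemma triangle_tree_open : is_open_graph T (5 * pi / 3).
Proof.
have pi0 := pi_gt0 R; apply: le_bigmin => [|p _]; first lra.
apply: vertex_openness_ge => a b ea eb ab; split.
  apply: gp => //; first by case/andP: ea.
  by case/andP: eb.
have [px|px] := eqVneq p x.
  have hubx q : T p q -> triangle_hub q = x.
    rewrite px => /andP[xq]; rewrite hub_x (negbTE xq).
    by move/eqP.
  by rewrite px; apply: cone_narrow uv_narrow _ _; apply: cone_x; apply: hubx.
have uvN : narrow (- u) (- v) by rewrite narrowN.
have [py|py] := eqVneq p y.
  by move: ea eb; rewrite py => /cone_y ca /cone_y cb; apply: cone_narrow uvN ca cb.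
have [pz|pz] := eqVneq p z.
  by move: ea eb; rewrite pz => /cone_z ca /cone_z cb; apply: cone_narrow uvN ca cb.
(* Every other vertex is the hub of no point, so its own hub is its only neighbour. *)
have leaf q : T p q -> q = triangle_hub p.
  move=> /andP[pq /orP[/eqP//|]]; case: (triangle_hubP q) => _ _ /eqP e.
  - by rewrite e eqxx in py.
  - by rewrite e eqxx in pz.
  - by rewrite e eqxx in px.
by rewrite (leaf a ea) (leaf b eb) eqxx in ab.
Qed.

End TriangleTree.

(** * Existence of the open spanning tree *)

Section OpenSpanningTree.
Variables (R : realType) (S : {fset 'rV[R]_2}).

Lemma general_position_cross : general_position S ->
  forall a b c : S, a != b -> a != c -> b != c ->
  cross (val b - val a) (val c - val a) != 0.
Proof.
move=> gp a b c ab ac bc; apply/eqP => abc0.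
by apply: (gp _ _ _ (fsvalP a) (fsvalP b) (fsvalP c) ab ac bc); apply: collinear_cross.
Qed.

(** A star at any point works: the conditions for planarity and openness concern three distinct
    points and hold vacuously. *)
Lemma star_open_spanning_tree : S != fset0 -> (#|{: S}| <= 2)%N ->
  exists T : rel S, plane_spanning_tree T /\ is_open_graph T (5 * pi / 3).
Proof.
move=> /fset0Pn[w wS] S2; pose x : S := [` wS]%fset.
have leaf_uniq (p q r : S) : p != q -> p != r -> q != r -> False.
  move=> pq pr qr; suff: (2 < #|{: S}|)%N by rewrite ltnNge S2.
  by apply/card_gt2P; exists p, q, r; split=> //; split=> //; rewrite eq_sym.
pose hub (p : S) := x; pose rank (p : S) : nat := (p != x).
have rank_hub p : hub p != p -> (rank (hub p) < rank p)%N.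
  by rewrite /hub /rank eqxx eq_sym => ->.
exists (hub_graph hub); split; [split|].
- by apply: hub_graph_plane => p q pq hp hq; case: (leaf_uniq x p q).
- by have root p : hub p = p -> p = x; [move=> <-|exact: (hub_graph_connect rank_hub root)].
- exact: (hub_graph_acyclic rank_hub).
have pi0 := pi_gt0 R; apply: le_bigmin => [|p _]; first lra.
apply: vertex_openness_ge => a b /andP[pa _] /andP[pb _] ab.
by case: (leaf_uniq p a b).
Qed.

Lemma open_spanning_tree : S != fset0 -> general_position S ->
  exists T : rel S, plane_spanning_tree T /\ is_open_graph T (5 * pi / 3).
Proof.
move=> S0 /general_position_cross gp.
have [/card_gt2P[a [b [c [_ [ab bc ca]]]]]|S2] := ltnP 2 #|{: S}|; last first.
  exact: star_open_spanning_tree.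
have [x [y [z [xyz_max abc xyz_narrow]]]] := largest_triangle a b c.
have uv0 : cross (val y - val x) (val z - val x) != 0.
  (* The triangle [abc] is nondegenerate by general position, hence so is the largest one. *)
  by rewrite -normr_gt0 (lt_le_trans _ abc)// normr_gt0 gp// eq_sym.
exists (hub_graph (triangle_hub x y z)); split.
  exact: triangle_tree_spanning.
exact: triangle_tree_open.
Qed.

End OpenSpanningTree.

(** * Optimality by an equilateral triangle of side [2] *)

Section EquilateralTriangle.
Variable R : realType.

Definition vec2 (s t : R) : 'rV[R]_2 := \row_i (if i == 0 then s else t).

Lemma vec2_0 s t : vec2 s t 0 0 = s. Proof. by rewrite mxE. Qed.

Definition equilateral : {fset 'rV[R]_2} :=
  [fset vec2 0 0; vec2 2 0; vec2 1 (Num.sqrt 3)]%fset.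

Lemma equilateral_dot a b c :
    a \in equilateral -> b \in equilateral -> c \in equilateral ->
    a != b -> a != c -> b != c ->
  [/\ dot (b - a) (b - a) = 4, dot (c - a) (c - a) = 4 &
      dot (b - a) (c - a) = 2].
Proof.
have s3 : Num.sqrt 3 ^+ 2 = 3 :> R by rewrite sqr_sqrtr.
rewrite !inE => /orP[/orP[]|] /eqP-> /orP[/orP[]|] /eqP-> /orP[/orP[]|] /eqP->;
  rewrite ?eqxx// => _ _ _; split; rewrite /dot !mxE /=; move: s3; rewrite expr2; lra.
Qed.

Lemma equilateral_general_position : general_position equilateral.
Proof.
move=> a b c aS bS cS ab ac bc [p [v [_ sub]]].
have [sa ea] : line p v a by apply: sub; left; left.
have [sb eb] : line p v b by apply: sub; left; right.
have [sc ec] : line p v c by apply: sub; right.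
have [bb cc bc2] := equilateral_dot aS bS cS ab ac bc.
(* For collinear points the cross product vanishes and Lagrange's identity would read
   [2^2 = 4 * 4]. *)
have := dot_cross_sqr (b - a) (c - a).
have -> : cross (b - a) (c - a) = 0 by rewrite /cross ea eb ec !mxE; ring.
by rewrite bb cc bc2; lra.
Qed.

(** The cosine is [2 / 4], so the angle is [pi / 3] or [5 * pi / 3], depending on the
    orientation. *)
Lemma equilateral_edge_angle (p a b : equilateral) :
  p != a -> p != b -> a != b -> edge_angle p a b <= 5 * pi / 3.
Proof.
move=> pa pb ab; have pi0 := pi_gt0 R.
have [aa bb ab2] := @equilateral_dot (val p) (val a) (val b)
  (fsvalP p) (fsvalP a) (fsvalP b) pa pb ab.
rewrite /edge_angle ccw_angleE /angle_cos /enorm aa bb ab2.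
have -> : Num.sqrt 4 * Num.sqrt 4 = 4 :> R by rewrite -expr2 sqr_sqrtr.
have -> : 2 / 4 = 2^-1 :> R by field.
by rewrite acos_half; case: ifP; lra.
Qed.

Lemma equilateral_openness (T : rel equilateral) : plane_spanning_tree T ->
  openness T <= 5 * pi / 3.
Proof.
move=> [[T_sym T_irr _] T_conn _]; have pi0 := pi_gt0 R.
have T_neq p q : T p q -> p != q.
  by move=> Tpq; apply: contraTneq Tpq => ->; rewrite T_irr.
have neighbour p q : p != q -> exists a, T p a.
  move=> pq; have /connectP[[/= _ e|a s /andP[pa _] _]] := T_conn p q.
    by rewrite e eqxx in pq.
  by exists a.
have [q0 [q1 [q2 [cover n01 n02 n12]]]] : exists q0 q1 q2 : equilateral,
    [/\ forall p, [\/ p = q0, p = q1 | p = q2], q0 != q1, q0 != q2 & q1 != q2].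
  have neq s t s' t' : s != s' -> vec2 s t != vec2 s' t'.
    by apply: contra_neq => /rowP/(_ 0); rewrite !vec2_0.
  have m0 : vec2 0 0 \in equilateral by rewrite !inE eqxx.
  have m1 : vec2 2 0 \in equilateral by rewrite !inE eqxx orbT.
  have m2 : vec2 1 (Num.sqrt 3) \in equilateral by rewrite !inE eqxx orbT.
  exists [` m0]%fset, [` m1]%fset, [` m2]%fset.
  split; [move=> p|apply: neq; lra|apply: neq; lra|apply: neq; lra].
  have := fsvalP p; rewrite !inE => /orP[/orP[]|] /eqP e.
  - by apply: Or31; apply: val_inj.
  - by apply: Or32; apply: val_inj.
  - by apply: Or33; apply: val_inj.
(* Let [a] be a neighbour of [q0] and [b] the third point. A neighbour of [b] is [q0] or [a], and
   that vertex then has two neighbours. *)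
have [c [a [b [ca cb ab]]]] : exists c a b, [/\ T c a, T c b & a != b].
  have [a T0a] := neighbour _ _ n01.
  have [b [b0 ba other]] : exists b, [/\ b != q0, b != a &
      forall c, b != c -> c = q0 \/ c = a].
    have a0 := T_neq _ _ T0a; case: (cover a) => ea.
    - by rewrite ea eqxx in a0.
    - exists q2; rewrite ea ![q2 == _]eq_sym; split=> // c.
      by case: (cover c) => ->; rewrite ?eqxx; [left|right|].
    - exists q1; rewrite ea [q1 == q0]eq_sym; split=> // c.
      by case: (cover c) => ->; rewrite ?eqxx; [left| |right].
  have [c Tbc] := neighbour _ _ b0; have Tcb : T c b by rewrite T_sym.
  have [cE|cE] := other _ (T_neq _ _ Tbc); rewrite cE in Tcb.
    by exists q0, a, b; rewrite eq_sym.
  by exists a, q0, b; rewrite T_sym eq_sym.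
apply: (@bigmin_inf _ _ _ _ c) => //; rewrite /vertex_openness.
case: leqP => [c1|_].
  suff: (1 < #|T c|)%N by rewrite ltnNge c1.
  by apply/card_gt1P; exists a, b.
apply: bigmax_le => [|[a' b'] /= /and4P[pa pb ne _]]; first lra.
by apply: equilateral_edge_angle => //; exact: T_neq.
Qed.

End EquilateralTriangle.

Theorem theorem2 (R : realType) :
  (forall S : {fset 'rV[R]_2}, S != fset0 -> general_position S ->
     exists T : rel S, plane_spanning_tree T /\ is_open_graph T (5 * pi / 3)) /\
  (forall eps : R, 0 < eps ->
     exists S : {fset 'rV[R]_2}, [/\ S != fset0, general_position S &
       forall T : rel S, plane_spanning_tree T ->
         openness T < 5 * pi / 3 + eps]).
Proof.
split=> [S|eps eps0]; first exact: open_spanning_tree.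
(* One triangle serves every [eps], since its bound does not involve [eps]. *)
exists (equilateral R); split=> [||T /equilateral_openness].
- by apply/fset0Pn; exists (vec2 0 0); rewrite !inE eqxx.
- exact: equilateral_general_position.
- by move=> /le_lt_trans -> //; rewrite ltrDl.
Qed.
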